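(* Let $(X,d)$ be a complete metric space with $|X|\geq 3$ and let $T\colon X\to X$ be a continuous asymptotically regular generalized Kannan type mapping with the coefficient $\lambda\in[0,\infty)$. Then $T$ has a fixed point, and the number of fixed points of $T$ is at most two.
   Context: Let $(X,d)$ be a metric space with $|X|\geq 3$. A mapping $T\colon X\to X$ is a generalized Kannan type mapping with the coefficient $\lambda\in[0,\infty)$ if the inequality $$d(Tx,Ty)+d(Ty,Tz)+d(Tx,Tz)\leq \lambda\,(d(x,Tx)+d(y,Ty)+d(z,Tz))$$ holds for all three pairwise distinct points $x,y,z\in X$. A mapping $T\colon X\to X$ is asymptotically regular if $\lim_{n\to\infty} d(T^{n+1}(x),T^n(x))=0$ for all $x\in X$. *)

(* Defs.v *)
From HB Require Import structures.
From mathcomp Require Import all_boot all_order all_algebra.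
From mathcomp Require Import all_classical all_reals all_analysis.
Set Implicit Arguments.
Unset Strict Implicit.
Unset Printing Implicit Defensive.
Import Order.TTheory GRing.Theory Num.Theory.
Import numFieldNormedType.Exports.
Local Open Scope classical_set_scope.
Local Open Scope ring_scope.

(* [Complete] also carries a distinguished point, so the empty space is
   excluded. *)
#[short(type="completeMetricType")]
HB.structure Definition CompleteMetric (K : numDomainType) :=
  { M of Metric K M & Complete M }.

Definition generalized_kannan (R : realType) (X : metricType R)
    (lambda : R) (T : X -> X) : Prop :=
  forall x y z : X, x != y -> y != z -> x != z ->
    mdist (T x) (T y) + mdist (T y) (T z) + mdist (T x) (T z) <=
      lambda * (mdist x (T x) + mdist y (T y) + mdist z (T z)).

Definition asymptotically_regular (R : realType) (X : metricType R)
    (T : X -> X) : Prop :=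
  forall x : X, mdist (iter n.+1 T x) (iter n T x) @[n --> \oo] --> (0 : R).

(* Main.v *)
Require Import Defs.
From HB Require Import structures.
From mathcomp Require Import all_boot all_order all_algebra.
From mathcomp Require Import all_classical all_reals all_analysis.
From mathcomp Require Import lra.
Import Order.TTheory GRing.Theory Num.Theory.
Import numFieldNormedType.Exports.
Local Open Scope classical_set_scope.
Local Open Scope ring_scope.
Local Open Scope card_scope.

(** Existence follows from the Picard orbit [x_n = T^n x].  If some [x_n] is
    fixed there is nothing to prove.  Otherwise consecutive terms of the orbit
    always differ, and the successor of [x_n] serves as the third point that
    the three-point inequality requires: applied to [x_m], [x_n], [x_(n+1)], it
    bounds [d(x_(m+1), x_(n+1))] by [lambda] times three displacements
    [d(x_k, x_(k+1))].  The degenerate positions [x_m = x_n] and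
    [x_m = x_(n+1)] are harmless, because there [d(x_(m+1), x_(n+1))] is zero
    or is itself a displacement ([kannan_dist_image_le]).  Asymptotic regularity
    makes the displacements small, so the orbit is Cauchy whatever the size of
    [lambda] ([kannan_orbit_cauchy]); by continuity its limit is fixed.

    At most two fixed points: for three distinct fixed points the right-hand
    side of the inequality vanishes while the left-hand side is a sum of
    positive distances. *)

Section GeneralizedKannan.
Variables (R : realType) (X : metricType R) (T : X -> X) (lambda : R).
Hypotheses (lambda_ge0 : 0 <= lambda) (T_kannan : generalized_kannan lambda T).

(** The third point is [T y], which is why [y] may not be fixed: two distinct
    fixed points have zero displacement but positive distance.  The summand [1]
    in the constant pays for the case [x = T y]. *)
Lemma kannan_dist_image_le (x y : X) (e : R) : y != T y ->
  mdist x (T x) <= e -> mdist y (T y) <= e ->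
  mdist (T y) (T (T y)) <= e ->
  mdist (T x) (T y) <= (1 + lambda * 3) * e.
Proof.
move=> yTy xe ye Tye.
have e0 : 0 <= e by exact: le_trans (mdist_ge0 _ _) xe.
have le0 : 0 <= lambda * e by exact: mulr_ge0.
have [->|xy] := eqVneq x y; first by rewrite mdistxx; lra.
have [xTy|xTy] := eqVneq x (T y).
  have -> : mdist (T x) (T y) = mdist x (T x) by rewrite metric_sym -xTy.
  lra.
have sum_le := T_kannan _ _ _ xy yTy xTy.
have : lambda * (mdist x (T x) + mdist y (T y) + mdist (T y) (T (T y))) <=
    lambda * (3 * e) by apply: ler_wpM2l => //; lra.
have := mdist_ge0 (T y) (T (T y)).
have := mdist_ge0 (T x) (T (T y)).
lra.
Qed.

Lemma kannan_orbit_cauchy (x : X) : asymptotically_regular T ->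
  (forall n, iter n T x != T (iter n T x)) ->
  cauchy (iter n T x @[n --> \oo]).
Proof.
move=> T_reg nofix; apply/cauchy_ballP => e e0; near_simpl.
pose c := 1 + lambda * 3.
have c0 : 0 < c by rewrite ltr_pwDl// mulr_ge0.
have [N _ dispN] : \forall n \near \oo,
    mdist (iter n T x) (T (iter n T x)) <= e / 2 / c.
  have d0 : 0 < e / 2 / c by rewrite !divr_gt0.
  apply: filterS (cvgr0_norm_le _ (T_reg x) _ d0) => n.
  by rewrite ger0_norm ?mdist_ge0// metric_sym.
exists ([set n | (N < n)%N], [set n | (N < n)%N]) => /=.
  by split; exact: nbhs_infty_gt.
(* Indices above [N] are successors, so both points are values of [T]. *)
move=> [[|m] [|n]] /= [Nm Nn] //; rewrite ballEmdist/=.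
apply: (@le_lt_trans _ _ (e / 2)); last by lra.
rewrite -[leRHS](divfK (lt0r_neq0 c0)) mulrC.
apply: kannan_dist_image_le; [exact: nofix | exact: dispN..|].
exact: (dispN n.+1 (leqW Nn)).
Qed.

Lemma kannan_fixed_points_le2 : [set x : X | T x = x] #<= `I_2.
Proof.
have [[a Ta]|nofix] := pselect (exists a, T a = a); last first.
  suff -> : [set x : X | T x = x] = set0 by exact: card_ge0.
  by apply/seteqP; split=> // x Tx; apply: nofix; exists x.
have [b coverb] : exists b, forall x, T x = x -> x = a \/ x = b.
  have [[b Tb ba]|onlya] := pselect (exists2 b, T b = b & b != a).
    exists b => x Tx; apply: contrapT => /not_orP[/eqP xa /eqP xb].
    have := T_kannan _ _ _ xb ba xa; rewrite Tx Tb Ta !mdistxx !addr0 mulr0.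
    move: xb ba xa; rewrite -!mdist_gt0; lra.
  exists a => x Tx; left; apply: contrapT => /eqP xa.
  by apply: onlya; exists x.
apply: card_le_trans (card_image_le (fun i : nat => if i is 0%N then a else b) _).
apply: subset_card_le => x /coverb[]->; first by exists 0%N.
by exists 1%N.
Qed.

End GeneralizedKannan.

Lemma cvg_orbit_fixed (X : topologicalType) (T : X -> X) (x p : X) :
  hausdorff_space X -> {for p, continuous T} ->
  iter n T x @[n --> \oo] --> p -> T p = p.
Proof.
move=> hX Tp xp.
have xTp : iter n.+1 T x @[n --> \oo] --> T p by exact: continuous_cvg.
have xSp : iter n.+1 T x @[n --> \oo] --> p.
  under eq_cvg => n do rewrite -addn1.
  exact: cvg_comp (cvg_addnr 1) xp.
exact: (cvg_unique hX xTp xSp).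
Qed.

Theorem corollary4p8 (R : realType) (X : completeMetricType R)
    (X_ge3 : `I_3 #<= [set: X]) (T : X -> X) (lambda : R)
    (lambda_ge0 : 0 <= lambda)
    (T_cont : continuous T)
    (T_reg : asymptotically_regular T)
    (T_kannan : generalized_kannan lambda T) :
  (exists x : X, T x = x) /\ [set x : X | T x = x] #<= `I_2.
Proof.
split; last exact: (kannan_fixed_points_le2 _ _ _ _ T_kannan).
pose x : X := point.
have [[n Tn]|nofix] := pselect (exists n, T (iter n T x) = iter n T x).
  by exists (iter n T x).
have xcauchy : cauchy (iter n T x @[n --> \oo]).
  apply: (kannan_orbit_cauchy _ _ _ _ lambda_ge0 T_kannan) => // n.
  by apply/eqP => Tn; apply: nofix; exists n.
have [p xp] := (cvg_ex _).1 (cauchy_cvg _ xcauchy).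
by exists p; apply: cvg_orbit_fixed xp; [exact: metric_hausdorff | exact: T_cont].
Qed.
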